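(* Let $\{a_k\}_{k=0}^{\infty}$ be a sequence of complex numbers and let $b_n = \sum_{k=0}^{n}\binom{n}{k}(-1)^{k-1}a_k$ for $n\ge 0$. Let $g(t)$ be a polynomial with complex coefficients. Then for every integer $n\ge 0$ with $n\ge \deg g$, $$\sum_{k=0}^{n}\binom{n}{k}(-1)^{k-1}g(k)\,a_k=g(n\nabla)\,b_n .$$ In particular, for every complex number $\lambda$ and every integer $n\geq 1$, $$\sum_{k=0}^{n}\binom{n}{k}(-1)^{k-1}(k+\lambda)\,a_k=(n\nabla+\lambda)b_n=(n+\lambda)b_n-nb_{n-1}.$$
   Context: The binomial transform of a sequence $\{a_k\}_{k\ge0}$ is the sequence $\{b_n\}_{n\ge0}$ with $b_n=\sum_{k=0}^{n}\binom{n}{k}(-1)^{k-1}a_k$ (the $k=0$ factor $(-1)^{-1}$ equals $-1$). The backward difference is $\nabla b_n=b_n-b_{n-1}$. The operator $n\nabla$ sends a sequence $b$ to the sequence whose $n$-th term is $n(b_n-b_{n-1})$. Its iterates are $(n\nabla)^0b_n=b_n$ and $(n\nabla)^{p}b_n=n\big(c_n-c_{n-1}\big)$ where $c_m=(m\nabla)^{p-1}b_m$, defined for $n\ge p$. For a polynomial $g(t)=\sum_{j=0}^{d}g_jt^j$, one sets $g(n\nabla)b_n=\sum_{j=0}^{d}g_j\,(n\nabla)^jb_n$, defined for $n\ge d=\deg g$. *)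

(* Defs.v *)
From mathcomp Require Import all_boot all_order all_algebra.
From mathcomp Require Import complex reals.
Set Implicit Arguments.
Unset Strict Implicit.
Unset Printing Implicit Defensive.
Import GRing.Theory.
Local Open Scope ring_scope.

Section BinomialTransform.
Variable F : fieldType.
Implicit Types (a b : nat -> F) (g : {poly F}) (n : nat).

(* The exponent is the integer k - 1, so the k = 0 factor is (-1)^(-1) = -1. *)
Definition binomial_transform a n : F :=
  \sum_(0 <= k < n.+1) 'C(n, k)%:R * (-1) ^ (k%:Z - 1) * a k.

(* Meaningful for n >= 1 only: at n = 0 the truncated predecessor gives the
   junk value 0. *)
Definition nabla b n : F := b n - b n.-1.

Definition nnabla b : nat -> F := fun n => n%:R * nabla b n.

(* The value at n of g(n nabla) b.  It depends only on genuine differences when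
   n >= deg g: the j-th iterate at n reads the (j-1)-st at n and n - 1 only, so
   nabla is never evaluated at 0 when j <= n. *)
Definition poly_nnabla g b n : F :=
  \sum_(j < size g) g`_j * iter j nnabla b n.

End BinomialTransform.

(* Main.v *)
Require Import Defs.
From mathcomp Require Import all_boot all_order all_algebra.
From mathcomp Require Import complex reals.
Set Implicit Arguments.
Unset Strict Implicit.
Unset Printing Implicit Defensive.
Import GRing.Theory.
Local Open Scope ring_scope.

(** The binomial transform diagonalises the operator [nnabla]: applying
    [nnabla] to the transform of [a] gives the transform of [k * a k]
    ([nnabla_binomial_transform]).  Coefficientwise this is the identity
    [n * ('C(n, k) - 'C(n.-1, k)) = k * 'C(n, k)], which combines Pascal's rule
    with the absorption identity.  Iterating, the [j]-th power of [nnabla]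
    becomes multiplication of [a k] by [k ^ j], and linearity turns a polynomial
    [g] in [nnabla] into multiplication by [g.[k]]
    ([poly_nnabla_binomial_transform]). *)

Section Diagonalisation.
Variable F : fieldType.
Implicit Types (a b : nat -> F) (g : {poly F}) (n k : nat).

(** At [n = 0] the truncated predecessor breaks Pascal's rule, but the weight
    [n] kills the left side, and on the right the factor [k] vanishes at
    [k = 0] and the binomial everywhere else. *)
Lemma natr_mul_bin_sub n k :
  n%:R * ('C(n, k)%:R - 'C(n.-1, k)%:R) = k%:R * 'C(n, k)%:R :> F.
Proof.
case: n k => [|n] [|k]; rewrite ?mul0r ?bin0n ?mulr0 //=.
  by rewrite !bin0 subrr mulr0.
by rewrite -[RHS]natrM -mul_bin_diag binS natrD addrC addKr natrM.
Qed.

(** Padding the range with vanishing binomials lets the sums at [n] and [n.-1]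
    be subtracted term by term. *)
Lemma binomial_transform_widen a m n : (m <= n)%N ->
  binomial_transform a m =
  \sum_(0 <= k < n.+1) 'C(m, k)%:R * (-1) ^ (k%:Z - 1) * a k.
Proof.
move=> le_mn; rewrite [RHS](big_cat_nat (leq0n m.+1)) //=.
rewrite [X in _ + X]big_nat_cond [X in _ + X]big1 ?addr0 // => k.
by rewrite andbT => /andP[lt_mk _]; rewrite bin_small // !mul0r.
Qed.

Lemma nnabla_binomial_transform a n :
  nnabla (binomial_transform a) n =
  binomial_transform (fun k => k%:R * a k) n.
Proof.
rewrite /nnabla /nabla (binomial_transform_widen a (leq_pred n)).
rewrite -sumrB mulr_sumr; apply: eq_bigr => k _.
by rewrite -!mulrA -mulrBl [LHS]mulrA natr_mul_bin_sub -mulrA mulrCA (mulrCA k%:R).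
Qed.

(** [b] is only assumed pointwise equal to the transform; since [nnabla] reads
    values at [n] and [n.-1] alone, the induction has to keep [n] general. *)
Lemma iter_nnabla_binomial_transform a b j n : b =1 binomial_transform a ->
  iter j (@nnabla F) b n = binomial_transform (fun k => k%:R ^+ j * a k) n.
Proof.
move=> eq_ba; elim: j n => [|j IHj] n.
  by rewrite /= eq_ba; apply: eq_bigr => k _; rewrite mul1r.
rewrite iterS {1}/nnabla /nabla !IHj -/(nabla _ n) -/(nnabla _ n).
rewrite nnabla_binomial_transform.
by apply: eq_bigr => k _; rewrite exprS !mulrA.
Qed.

Lemma poly_nnabla_binomial_transform a b g n : b =1 binomial_transform a ->
  poly_nnabla g b n = binomial_transform (fun k => g.[k%:R] * a k) n.
Proof.
move=> eq_ba; rewrite /poly_nnabla.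
under eq_bigr => j _ do
  rewrite (iter_nnabla_binomial_transform _ _ eq_ba) mulr_sumr.
rewrite exchange_big /=; apply: eq_bigr => k _.
rewrite horner_coef mulr_suml mulr_sumr; apply: eq_bigr => j _.
by rewrite mulrCA -!mulrA.
Qed.

Lemma poly_nnabla_XaddC c b n :
  poly_nnabla ('X + c%:P) b n = (n%:R + c) * b n - n%:R * b n.-1.
Proof.
rewrite /poly_nnabla size_XaddC !big_ord_recl big_ord0 /= !coefD !coefX !coefC.
by rewrite /= add0r !addr0 mul1r /nnabla /nabla mulrBr addrA mulrDl (addrC (c * _)).
Qed.

End Diagonalisation.

Theorem corollary1 (R : realType) (a b : nat -> R[i])
    (hb : forall n : nat, b n = binomial_transform a n) :
  (forall (g : {poly R[i]}) (n : nat), ((size g).-1 <= n)%N ->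
     \sum_(0 <= k < n.+1) 'C(n, k)%:R * (-1) ^ (k%:Z - 1) * g.[k%:R] * a k
     = poly_nnabla g b n)
  /\
  (forall (lambda : R[i]) (n : nat), (1 <= n)%N ->
     \sum_(0 <= k < n.+1)
        'C(n, k)%:R * (-1) ^ (k%:Z - 1) * (k%:R + lambda) * a k
     = poly_nnabla ('X + lambda%:P) b n
     /\
     poly_nnabla ('X + lambda%:P) b n
     = (n%:R + lambda) * b n - n%:R * b n.-1).
Proof.
split=> [g n _ | lambda n _].
  rewrite (poly_nnabla_binomial_transform _ _ hb).
  by apply: eq_bigr => k _; rewrite mulrA.
split; last exact: poly_nnabla_XaddC.
rewrite (poly_nnabla_binomial_transform _ _ hb).
by apply: eq_bigr => k _; rewrite hornerD hornerX hornerC mulrA.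
Qed.
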